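(* Let $G$ be a simple graph on $n$ vertices and let $c$ be a colouring of $E(G)$ using $n$ colours, such that each colour class has size at least $2$. Then $G$ contains a cycle of length at most $\lceil n/2 \rceil$ whose edges all receive distinct colours under $c$ (a rainbow cycle).
   Context: A subgraph $H$ of an edge-coloured graph $(G,c)$ is rainbow if no two edges of $H$ have the same colour. A colour class is the set of edges receiving a given colour. *)

(* Defs.v *)
From mathcomp Require Export all_boot.

Set Implicit Arguments.
Unset Strict Implicit.
Unset Printing Implicit Defensive.

Section RainbowCycles.

Variable T : finType.

(* A simple graph on the vertex set T is a symmetric, irreflexive relation; an
   edge is the two-element set of its endpoints. *)
Definition simple_graph (e : rel T) : Prop := symmetric e /\ irreflexive e.

Definition edges (e : rel T) : {set {set T}} :=
  [set [set p.1; p.2] | p : T * T & e p.1 p.2].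

(* A colouring of E(G) is given by a total function on {set T}; its values
   outside of [edges e] are never used. *)
Definition colour_class (e : rel T) (C : finType) (c : {set T} -> C) (k : C) :
  {set {set T}} := [set f in edges e | c f == k].

(* Closed sequence of at least three distinct vertices; its length is [size p]. *)
Definition graph_cycle (e : rel T) (p : seq T) : Prop :=
  ucycle e p /\ 3 <= size p.

Definition cycle_edges (p : seq T) : {set {set T}} :=
  [set [set x; next p x] | x in p].

Definition rainbow (C : finType) (c : {set T} -> C) (F : {set {set T}}) : Prop :=
  {in F &, injective c}.

End RainbowCycles.

(* Main.v *)
Require Import Defs.
From mathcomp Require Import all_boot.
From mathcomp Require Import zify.

Set Implicit Arguments.
Unset Strict Implicit.
Unset Printing Implicit Defensive.

(** The proof is by induction on [n], for multigraphs with exactly two non-parallel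
    edges of each colour.  Contracting a connected set [X] and discarding fewer than
    [#|X|] colours yields a smaller instance; a rainbow closed walk of the contraction
    lifts to one that is longer by at most the diameter of [X].  A colour survives a
    contraction unless it has an edge inside [X], or it is a _star_ [{wa, wb}] whose
    leaves [a], [b] both lie in [X].

    For odd [n] it suffices to contract one edge that is not the leaf pair of a star;
    there is one, since there are twice as many edges as colours.

    For even [n = 2h] one must lose two vertices for each unit of length.  Let
    [{uv, uy}] be a star such that [uv] is not a leaf pair.  If [y] has another edge
    [yy'] that is not a leaf pair, contracting [uv] and [yy'] gives a short rainbow
    [y]-[y'] walk through the contracted [uv], and the edges [uy] and [yy'] close up a
    part of it.  Otherwise all other edges at [y] are leaf pairs of stars centred at
    neighbours of [y], and following these stars backwards either reaches the triangle
    [uvy], which can be contracted, or closes up to a wheel with hub [y] and more than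
    [h] spokes, which leaves too few vertices.  Hence both edges of every star are leaf
    pairs, and counting shows that there is no star at all.  Then contracting a vertex
    with four or more neighbours together with all of these loses at least four
    vertices and lengthens walks by at most two. *)

Lemma uniq_map_inj_in (T1 T2 : eqType) (f : T1 -> T2) (s : seq T1) :
  uniq (map f s) -> {in s &, injective f}.
Proof.
elim: s => // a s IHs /=/andP[fas us] x y; rewrite !inE.
case/predU1P=> [->|xs] /predU1P[->|ys] fxy //; last exact: IHs.
  by rewrite fxy map_f in fas.
by rewrite -fxy map_f in fas.
Qed.

Lemma eq_set2 (T : finType) (a b x y : T) :
  [set a; b] = [set x; y] -> (a = x /\ b = y) \/ (a = y /\ b = x).
Proof.
move=> Eab; have /set2P ax : a \in [set x; y] by rewrite -Eab set21.
have /set2P bx : b \in [set x; y] by rewrite -Eab set22.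
have /set2P xa : x \in [set a; b] by rewrite Eab set21.
have /set2P ya : y \in [set a; b] by rewrite Eab set22.
by case: ax bx xa ya => -> [] -> [] ? [] ?; auto.
Qed.

Lemma card_notin (T : finType) (A : {set T}) : #|{: {x | x \notin A}}| = #|T| - #|A|.
Proof. by rewrite card_sig -(cardC A) addKn. Qed.

Lemma insub_notin_eq (T : finType) (A : {set T}) x y :
  insub x = insub y :> option {z | z \notin A} -> x = y \/ x \in A /\ y \in A.
Proof.
case: insubP => [u _ <-|/negPn xA]; case: insubP => [v _ <-|/negPn yA] //.
  by case=> ->; left.
by right.
Qed.

Section Multigraphs.

Variables V C : finType.
Implicit Types (e : C -> bool -> V * V) (k : C) (ks : seq C) (X : {set V}) (K : {set C}).

(* The two edges of colour [k] join the components of [e k true] and those of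
   [e k false]; loops are allowed. *)
Definition ends (p : V * V) : {set V} := [set p.1; p.2].

Definition adj e k x y : bool := [exists b, ends (e k b) == [set x; y]].

Definition nondegenerate e k : bool := ends (e k true) != ends (e k false).

Definition star e k w a b : bool := [&& a != b, adj e k w a & adj e k w b].

Definition leaf_pair_at e w a b : bool := [exists k, star e k w a b].

Definition leaf_pair e a b : bool := [exists w, leaf_pair_at e w a b].

Definition neighbours e x : {set V} := [set y | [exists k, adj e k x y]].

Definition colours_at e x : {set C} := [set k | [exists y, adj e k x y]].

(* A walk is recorded by its sequence of colours only, so that being rainbow is [uniq]. *)
Fixpoint walk e x ks y : bool :=
  if ks is k :: ks' then [exists z, adj e k x z && walk e z ks' y] else x == y.

Definition rainbow_closed e ks : bool :=
  [&& ks != [::], uniq ks & [exists x, walk e x ks x]].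

Definition rainbow_girth_gt h e : Prop := forall ks, rainbow_closed e ks -> h < size ks.

Definition rainbow_linked e X K D : Prop :=
  {in X &, forall x y, exists ks,
     [/\ walk e x ks y, uniq ks, size ks <= D & {subset ks <= K}]}.

Definition colour_clique e X K : Prop :=
  {in X &, forall x y, x != y -> exists2 k, k \in K & adj e k x y}.

Definition rainbow_spokes e X K u : Prop :=
  {in X, forall x, x != u -> exists2 k, k \in K & adj e k u x} /\
  {in K, forall k, {in X &, forall a b, ~~ star e k u a b}}.

(* The vertex [None] is the contracted set [X]. *)
Definition contract X K e :
    {k | k \notin K} -> bool -> option {x | x \notin X} * option {x | x \notin X} :=
  fun i b => (insub (e (val i) b).1, insub (e (val i) b).2).

Lemma adj_edge e k b : adj e k (e k b).1 (e k b).2.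
Proof. by apply/existsP; exists b. Qed.

Lemma adj_sym e k x y : adj e k x y = adj e k y x.
Proof. by rewrite /adj setUC. Qed.

Lemma mem_neighbours e k x y : adj e k x y -> y \in neighbours e x.
Proof. by move=> xy; rewrite inE; apply/existsP; exists k. Qed.

Lemma mem_colours_at e k x y : adj e k x y -> k \in colours_at e x.
Proof. by move=> xy; rewrite inE; apply/existsP; exists y. Qed.

Lemma leaf_pair_atI e k w a b : star e k w a b -> leaf_pair_at e w a b.
Proof. by move=> s; apply/existsP; exists k. Qed.

Lemma leaf_pairI e k w a b : star e k w a b -> leaf_pair e a b.
Proof. by move=> s; apply/existsP; exists w; apply: leaf_pair_atI s. Qed.

Lemma leaf_pairP e a b : reflect (exists k w, star e k w a b) (leaf_pair e a b).
Proof.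
apply: (iffP existsP) => [[w /existsP[k s]]|[k [w /leaf_pair_atI s]]]; last by exists w.
by exists k, w.
Qed.

Lemma leaf_pair_at_neighbour e w a b : leaf_pair_at e w a b -> w \in neighbours e a.
Proof.
case/existsP=> k /and3P[_ wa _]; apply: (mem_neighbours (k := k)).
by rewrite adj_sym.
Qed.

Lemma starC e k w a b : star e k w a b = star e k w b a.
Proof. by rewrite /star eq_sym [adj e k w a && _]andbC. Qed.

Lemma leaf_pairC e a b : leaf_pair e a b = leaf_pair e b a.
Proof. by apply: eq_existsb => w; apply: eq_existsb => k; apply: starC. Qed.

Lemma star_set2 e k w a b x y : x \in [set a; b] -> y \in [set a; b] ->
  star e k w x y -> star e k w a b.
Proof. by move=> /set2P[]-> /set2P[]->; rewrite // 1?starC // /star eqxx. Qed.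

Lemma star_adj e k w a b x y : star e k w a b -> adj e k x y ->
  [set x; y] = [set w; a] \/ [set x; y] = [set w; b].
Proof.
case/and3P=> ab /existsP[i /eqP Ei] /existsP[j /eqP Ej] /existsP[l /eqP <-].
have ij : i != j.
  apply: contraNneq ab => Eij; move: Ej; rewrite -Eij Ei => /eq_set2[[_ ->//]|[-> ->//]].
rewrite -Ei -Ej; case: i j l ij {Ei Ej} => [] [] [] // _; auto.
Qed.

Lemma star_inj e k w a b w' a' b' : w != a -> w != b ->
  star e k w a b -> star e k w' a' b' -> w' = w /\ [set a'; b'] = [set a; b].
Proof.
move=> wa wb swab /and3P[ab' /(star_adj swab)Ea' /(star_adj swab)Eb'].
case: Ea' Eb' => /eq_set2[][Ew Ea] [] /eq_set2[][Ew' Eb].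
all: by move: ab' wa wb; rewrite Ea Eb -?Ew -?Ew' ?eqxx // setUC.
Qed.

Lemma walk1 e x k y : walk e x [:: k] y = adj e k x y.
Proof.
apply/existsP/idP => [[z /andP[xz /eqP<-]] //|xy].
by exists y; rewrite xy eqxx.
Qed.

Lemma walk_cat e x ks1 ks2 y :
  walk e x (ks1 ++ ks2) y = [exists z, walk e x ks1 z && walk e z ks2 y].
Proof.
elim: ks1 x => [|k ks1 IHks] x /=.
  apply/idP/existsP => [w|[z /andP[/eqP->]] //].
  by exists x; rewrite eqxx.
apply/existsP/existsP => [[t /andP[xt]]|[z /andP[/existsP[t /andP[xt w1]] w2]]].
  rewrite IHks => /existsP[z /andP[w1 w2]].
  by exists z; rewrite w2 andbT; apply/existsP; exists t; rewrite xt.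
by exists t; rewrite xt IHks; apply/existsP; exists z; rewrite w1.
Qed.

Lemma walk_trans e y x ks1 ks2 z :
  walk e x ks1 y -> walk e y ks2 z -> walk e x (ks1 ++ ks2) z.
Proof. by move=> w1 w2; rewrite walk_cat; apply/existsP; exists y; rewrite w1. Qed.

Lemma walk_rev e x ks y : walk e x (rev ks) y = walk e y ks x.
Proof.
elim: ks x y => [|k ks IHks] x y; first exact: eq_sym.
rewrite rev_cons -cats1 walk_cat /=; apply: eq_existsb => z.
by rewrite IHks -[[exists t, _]]/(walk e z [:: k] y) walk1 adj_sym andbC.
Qed.

Lemma rainbow_closed_walk e x ks :
  ks != [::] -> uniq ks -> walk e x ks x -> rainbow_closed e ks.
Proof. by move=> ks0 uks w; rewrite /rainbow_closed ks0 uks; apply/existsP; exists x. Qed.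

Lemma short_rainbow_closed_or_girth_gt h e :
  (exists2 ks, rainbow_closed e ks & size ks <= h) \/ rainbow_girth_gt h e.
Proof.
have [/existsP[n /existsP[ks cks]]|no] :=
    boolP [exists n : 'I_h.+1, [exists ks : n.-tuple C, rainbow_closed e ks]].
  by left; exists ks; rewrite // size_tuple -ltnS.
right=> ks cks; rewrite ltnNge; apply: contra no => ksh.
apply/existsP; exists (Ordinal (ksh : size ks < h.+1)).
by apply/existsP; exists (in_tuple ks).
Qed.

Lemma clique_rainbow_linked e X K : colour_clique e X K -> rainbow_linked e X K 1.
Proof.
move=> clique x y xX yX; have [->|xy] := eqVneq x y.
  by exists [::]; split; rewrite //= eqxx.
have [k kK kxy] := clique x y xX yX xy.
by exists [:: k]; split; rewrite ?walk1 // => i; rewrite inE => /eqP->.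
Qed.

Lemma rainbow_spokes_linked e X K u : rainbow_spokes e X K u -> u \in X ->
  rainbow_linked e X K 2.
Proof.
case=> spoke nostar uX x y xX yX; have [->|xy] := eqVneq x y.
  by exists [::]; split; rewrite //= eqxx.
have [xu|xu] := eqVneq x u.
  have [|k kK uy] := spoke y yX; first by rewrite -xu eq_sym.
  by exists [:: k]; split; rewrite ?walk1 ?xu // => i; rewrite inE => /eqP->.
have [k kK ux] := spoke x xX xu; have [yu|yu] := eqVneq y u.
  by exists [:: k]; split; rewrite ?walk1 ?yu 1?adj_sym // => i; rewrite inE => /eqP->.
have [j jK uy] := spoke y yX yu; exists [:: k; j]; split=> //.
- by apply: (@walk_trans _ u _ [:: k] [:: j]); rewrite walk1 // adj_sym.
- rewrite /= inE andbT; apply: contraNneq (nostar k kK x y xX yX) => kj.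
  by rewrite /star xy ux kj.
by move=> i; rewrite !inE => /pred2P[]->.
Qed.

End Multigraphs.

Section Contraction.

Variables V C : finType.
Implicit Types (e : C -> bool -> V * V) (X : {set V}) (K : {set C}).

Lemma adj_contract X K e (k : {k | k \notin K}) a b : adj (contract X e) k a b ->
  exists x y, [/\ insub x = a, insub y = b & adj e (val k) x y].
Proof.
case/existsP=> i /eqP/eq_set2[][<- <-].
  by exists (e (val k) i).1, (e (val k) i).2; rewrite adj_edge.
by exists (e (val k) i).2, (e (val k) i).1; rewrite adj_sym adj_edge.
Qed.

Lemma contract_degenerate X K e (k : {k | k \notin K}) :
  nondegenerate e (val k) -> ~~ nondegenerate (contract X e) k ->
  (exists a b, [/\ a \in X, b \in X & adj e (val k) a b]) \/
  (exists w a b, [/\ w \notin X, a \in X, b \in X & star e (val k) w a b]).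
Proof.
rewrite /nondegenerate negbK /contract /= /ends /=.
have := adj_edge e (val k) true; have := adj_edge e (val k) false.
case: (e (val k) true) (e (val k) false) => [a b] [c d] /= cd ab.
wlog: c d cd / (insub a = insub c :> option {x | x \notin X}) /\
               (insub b = insub d :> option {x | x \notin X}).
  move=> gen nd /eqP Ef; case/eq_set2: (Ef) => Eacbd.
    by apply: (gen c d); rewrite // Ef.
  by apply: (gen d c); rewrite // 1?adj_sym 1?[[set d; c]]setUC // Ef setUC.
case=> /insub_notin_eq acX /insub_notin_eq bdX nd _.
case: acX cd nd => [<-|[aX cX]] cd nd; case: bdX cd nd => [<-|[bX dX]] cd nd.
- by rewrite eqxx in nd.
- have [aX|aX] := boolP (a \in X); first by left; exists a, b.
  right; exists a, b, d; split; rewrite // /star ab cd !andbT.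
  by apply: contraNneq nd => ->.
- have [bX|bX] := boolP (b \in X); first by left; exists a, b.
  right; exists b, a, c; split; rewrite // /star ![adj e _ b _]adj_sym ab cd !andbT.
  by apply: contraNneq nd => ->.
by left; exists a, b.
Qed.

Lemma contract_nondegenerate X K e (k : {k | k \notin K}) :
  nondegenerate e (val k) -> {in X &, forall a b, ~~ adj e (val k) a b} ->
  (forall w, w \notin X -> {in X &, forall a b, ~~ star e (val k) w a b}) ->
  nondegenerate (contract X e) k.
Proof.
move=> nk no_inner no_star; apply: contraT => /(contract_degenerate nk).
case=> [[a [b [aX bX ab]]]|[w [a [b [wX aX bX sw]]]]].
  by case/negP: (no_inner a b aX bX).
by case/negP: (no_star w wX a b aX bX).
Qed.

Section Uncontract.

Variables (e : C -> bool -> V * V) (X : {set V}) (K : {set C}).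
Let e' : {k | k \notin K} -> bool -> _ := contract X e.
Implicit Types (x y : V) (t : seq {k | k \notin K}).

Lemma walk_uncontract_prefix x t b : x \notin X -> walk e' (insub x) t b ->
  (exists2 y, insub y = b & walk e x (map val t) y) \/
  exists t1 t2 p,
    [/\ t = t1 ++ t2, p \in X, walk e x (map val t1) p & walk e' None t2 b].
Proof.
elim: t x => [|k t IHt] x xX /=.
  by move/eqP=> xb; left; exists x.
case/existsP=> c /andP[/adj_contract[x' [y [Ex <- xy]]] w].
have {x' Ex}xy : adj e (val k) x y.
  by case/insub_notin_eq: Ex xy => [->|[_]] //; rewrite (negPf xX).
have [yX|yX] := boolP (y \in X).
  rewrite insubN ?negbK // in w; right; exists [:: k], t, y.
  by split; rewrite // [map _ _]/= walk1.
have [[z Ez wz]|[t1 [t2 [p [-> pX wp wq]]]]] := IHt y yX w.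
  by left; exists z => //; apply/existsP; exists y; rewrite xy.
right; exists (k :: t1), t2, p; split=> //.
by apply/existsP; exists y; rewrite xy.
Qed.

Lemma walk_uncontract x t y : x \notin X -> y \notin X ->
  walk e' (insub x) t (insub y) ->
  walk e x (map val t) y \/
  exists t1 t0 t2 p q, [/\ t = t1 ++ t0 ++ t2, p \in X, q \in X,
    walk e x (map val t1) p & walk e q (map val t2) y].
Proof.
move=> xX yX /(walk_uncontract_prefix xX)[[z]|[t1 [t2 [p [-> pX wp]]]]].
  by case/insub_notin_eq=> [->|[_]]; [left | rewrite (negPf yX)].
rewrite -walk_rev => /(walk_uncontract_prefix yX)[[q]|[s2 [s0 [q [Et2 qX wq _]]]]].
  case: insubP => // /negPn qX _; rewrite map_rev walk_rev => wq.
  by right; exists t1, [::], t2, p, q.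
right; exists t1, (rev s0), (rev s2), p, q; split=> //; last by rewrite map_rev walk_rev.
by rewrite -rev_cat -Et2 revK.
Qed.

Lemma rainbow_closed_uncontract t : rainbow_closed e' t ->
  exists ks p q, [/\ ks != [::], uniq ks, size ks <= size t,
    {in ks, forall k, k \notin K} &
    walk e p ks q /\ ((p == q) || (p \in X) && (q \in X))].
Proof.
move=> ct; suff [s [p [q [s0 us st w pq]]]] : exists (s : seq {k | k \notin K}) p q,
    [/\ s != [::], uniq s, size s <= size t,
        walk e p (map val s) q & (p == q) || (p \in X) && (q \in X)].
  exists (map val s), p, q; split; rewrite ?size_map ?(map_inj_uniq val_inj) //.
    by case: (s) s0.
  by move=> _ /mapP[k _ ->]; apply: (valP k).
case/and3P: ct => t0 ut /existsP[a wa].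
wlog [x xX Ea] : t t0 ut a wa / exists2 x, x \notin X & a = insub x.
  move=> lift.
  have some_notin (v : {x | x \notin X}) : exists2 x, x \notin X & Some v = insub x.
    by exists (val v); rewrite ?valK ?(valP v).
  case: a wa => [v wa|]; first exact: lift wa (some_notin v).
  case: t t0 ut => // k t _ ukt /existsP[[v|] /andP[kv wt]]; last first.
    have [p [q [Ep Eq pq]]] := adj_contract kv.
    exists [:: k], p, q; split; rewrite ?walk1 //.
    by move: Ep Eq; do 2!case: insubP => // /negPn-> _; rewrite orbT.
  have := lift (rcons t k); rewrite size_rcons; apply; last exact: some_notin v.
  - by case: (t).
  - by rewrite rcons_uniq.
  by rewrite -cats1; apply: walk_trans wt _; rewrite walk1.
rewrite {a}Ea in wa; case: (walk_uncontract xX xX wa) => [w|].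
  by exists t, x, x; split; rewrite ?eqxx.
case=> t1 [t0' [t2 [p [q [Et pX qX w1 w2]]]]]; exists (t2 ++ t1), q, p; split.
- apply/negP=> /eqP; case: t2 t1 {Et} w1 w2 => // -[] // /eqP xp _.
  by rewrite xp pX in xX.
- by move: ut; rewrite Et catA uniq_catC !catA cat_uniq => /and3P[].
- by rewrite Et !size_cat; lia.
- by rewrite map_cat; apply: walk_trans w2 w1.
by rewrite pX qX orbT.
Qed.

Lemma rainbow_closed_contract_size h D t : rainbow_linked e X K D ->
  rainbow_girth_gt h e -> rainbow_closed e' t -> h < size t + D.
Proof.
move=> linked girth /rainbow_closed_uncontract[ks [p [q [ks0 uks kst ksK [w pq]]]]].
have [js [wjs ujs jsD jsK]] : exists js,
    [/\ walk e q js p, uniq js, size js <= D & {subset js <= K}].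
  case/predU1P: pq => [->|/andP[pX qX]]; last exact: linked.
  by exists [::]; split=> //=.
have /girth : rainbow_closed e (ks ++ js).
  apply: rainbow_closed_walk (walk_trans w wjs); first by case: (ks) ks0.
  rewrite cat_uniq uks ujs andbT; apply/hasPn=> k /jsK kK.
  by apply: contraL kK => /ksK.
by rewrite size_cat => long; apply: leq_trans long (leq_add kst jsD).
Qed.

End Uncontract.

End Contraction.

Section RainbowGirth.

Variables (V C : finType) (e : C -> bool -> V * V) (h : nat).
Hypothesis girth : rainbow_girth_gt h e.

Lemma closing_edge_girth x ks k y :
  walk e x ks y -> adj e k y x -> uniq (k :: ks) -> h <= size ks.
Proof.
move=> w yx ukks; apply: (girth (ks := k :: ks)).
apply: (rainbow_closed_walk (x := y)) => //.
by apply/existsP; exists x; rewrite yx.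
Qed.

Lemma adj_neq k x y : 0 < h -> adj e k x y -> x != y.
Proof.
rewrite ltnNge => h_gt0 xy; apply: contraNneq h_gt0 => Exy; rewrite Exy in xy.
by apply: (closing_edge_girth (ks := [::])) xy _; rewrite /=.
Qed.

Lemma adj_set2 k a b x y : 0 < h -> x \in [set a; b] -> y \in [set a; b] ->
  adj e k x y -> adj e k a b.
Proof.
move=> h_gt0 /set2P[]-> /set2P[]-> xy; rewrite // 1?adj_sym //;
  by have := adj_neq h_gt0 xy; rewrite eqxx.
Qed.

Lemma adj_colour_inj k j x y : 1 < h -> adj e k x y -> adj e j x y -> k = j.
Proof.
rewrite ltnNge adj_sym => h_gt1 yx xy; apply: contraNeq h_gt1 => kj.
by apply: (closing_edge_girth (ks := [:: j])) yx _; rewrite ?walk1 //= inE kj.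
Qed.

Lemma no_rainbow_triangle i j k x y z : 2 < h -> uniq [:: i; j; k] ->
  adj e i x y -> adj e j y z -> adj e k z x -> False.
Proof.
move=> h_gt2 uijk xy yz zx; have : h <= size [:: i; j]; last by rewrite leqNgt h_gt2.
apply: closing_edge_girth zx _; last by rewrite -(rotr1_rcons k [:: i; j]) rotr_uniq.
by apply: (@walk_trans _ _ _ y _ [:: i] [:: j]); rewrite walk1.
Qed.

Lemma star_neq k w a b : 0 < h -> star e k w a b -> w != a /\ w != b.
Proof.
by move=> h_gt0 /and3P[_ wa wb]; rewrite (adj_neq h_gt0 wa) (adj_neq h_gt0 wb).
Qed.

Lemma star_leaves_inj k w a b w' a' b' : 0 < h ->
  star e k w a b -> star e k w' a' b' -> w' = w /\ [set a'; b'] = [set a; b].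
Proof.
by move=> h_gt0 swab; have [wa wb] := star_neq h_gt0 swab; apply: star_inj swab.
Qed.

Lemma nondegenerate_card_gt2 k : 0 < h -> nondegenerate e k -> 2 < #|V|.
Proof.
move=> h_gt0; rewrite ltnNge; apply: contra => V_gt2; apply/eqP.
suff endsT b : ends (e k b) = setT by rewrite !endsT.
by apply/eqP; rewrite eqEcard subsetT cardsT cards2 (adj_neq h_gt0 (adj_edge e k b)).
Qed.

Lemma clique_no_inner_edge (X : {set V}) (K : {set C}) k : 1 < h ->
  colour_clique e X K -> k \notin K -> {in X &, forall x y, ~~ adj e k x y}.
Proof.
move=> h_gt1 clique kK x y xX yX; apply/negP=> xy.
have [i iK ixy] := clique x y xX yX (adj_neq (ltnW h_gt1) xy).
by rewrite (adj_colour_inj h_gt1 xy ixy) iK in kK.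
Qed.

Lemma rainbow_spokes_no_inner_edge (X : {set V}) (K : {set C}) u k : 2 < h ->
  rainbow_spokes e X K u -> k \notin K -> {in X &, forall x y, ~~ adj e k x y}.
Proof.
move=> h_gt2 [spoke nostar] kK x y xX yX; apply/negP=> xy.
have h_gt1 := ltnW h_gt2; have nxy := adj_neq (ltnW h_gt1) xy.
have no_spoke z : z \in X -> z != u -> ~~ adj e k u z.
  move=> zX zu; have [i iK uz] := spoke z zX zu.
  by apply/negP=> /(adj_colour_inj h_gt1 uz) ik; rewrite -ik iK in kK.
have [xu|xu] := eqVneq x u.
  by have := no_spoke y yX; rewrite -xu eq_sym nxy xy => /(_ isT).
have [yu|yu] := eqVneq y u.
  by have := no_spoke x xX xu; rewrite -yu adj_sym xy.
have [i iK ux] := spoke x xX xu; have [j jK uy] := spoke y yX yu.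
have ij : i != j.
  apply: contraNneq (nostar i iK x y xX yX) => ij.
  by rewrite /star nxy ux ij.
have ik : i != k by apply: contraNneq kK => <-.
have kj : k != j by apply: contraNneq kK => ->.
apply: (@no_rainbow_triangle i k j u x y); rewrite // 1?adj_sym //=.
by rewrite !inE negb_or ik ij kj.
Qed.

Lemma contract_edge_degenerate (K : {set C}) i a b (k : {k | k \notin K}) :
  1 < h -> i \in K -> adj e i a b -> nondegenerate e (val k) ->
  ~~ nondegenerate (contract [set a; b] e) k -> exists w, star e (val k) w a b.
Proof.
move=> h_gt1 iK ab nk dk; have h_gt0 := ltnW h_gt1.
have [[x [y [xX yX xy]]]|[w [x [y [_ xX yX swxy]]]]] := contract_degenerate nk dk.
  by case/negP: (valP k); rewrite -(adj_colour_inj h_gt1 ab (adj_set2 h_gt0 xX yX xy)).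
by exists w; apply: star_set2 xX yX swxy.
Qed.

End RainbowGirth.

Lemma edge_rainbow_linked (V C : finType) (e : C -> bool -> V * V) k a b :
  adj e k a b -> rainbow_linked e [set a; b] [set k] 1.
Proof.
move=> ab; apply: clique_rainbow_linked => x y.
by do 2!case/set2P=> ->; rewrite ?eqxx // => _; exists k; rewrite ?inE // adj_sym.
Qed.

(* Contracting an edge of a colour other than [j] leaves [j] nondegenerate unless that
   edge is the leaf pair of the star [j], and two colours cannot share an edge. *)
Lemma rainbow_closed_lt_card (V C : finType) (e : C -> bool -> V * V) j :
  #|V| <= #|C| -> nondegenerate e j -> exists2 ks, rainbow_closed e ks & size ks < #|V|.
Proof.
have [n] := ubnP #|V|; elim: n V C e j => // n IHn V C e j Vn card_VC nj.
have V_gt0 : 0 < #|V| by apply/card_gt0P; exists (e j true).1.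
have [[ks cks ksV]|girth] := short_rainbow_closed_or_girth_gt #|V|.-1 e.
  by exists ks; rewrite // -(prednK V_gt0).
have V_gt1 : 1 < #|V|.
  rewrite ltnNge; apply: contra nj => /card_le1_eqP V_gt1.
  rewrite /ends (V_gt1 (e j true).1 (e j false).1) //.
  by rewrite (V_gt1 (e j true).2 (e j false).2).
have h_gt0 : 0 < #|V|.-1 by rewrite -ltnS prednK.
have V_gt2 := nondegenerate_card_gt2 girth h_gt0 nj.
have h_gt1 : 1 < #|V|.-1 by rewrite -ltnS prednK.
have leaves k : k != j -> exists w, star e j w (e k true).1 (e k true).2.
  move=> kj; pose X : {set V} := ends (e k true).
  have jk : j \notin [set k] by rewrite inE eq_sym.
  have cX : #|X| = 2 by rewrite cards2 (adj_neq girth h_gt0 (adj_edge e k true)).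
  apply: (contract_edge_degenerate girth h_gt1 (set11 k) (adj_edge e k true)
    (k := exist _ j jk)) => //; apply/negP=> nondegen_j.
  have [||t ct] := IHn _ _ (contract X e) (exist _ j jk) _ _ nondegen_j.
  - by rewrite card_option card_notin cX; lia.
  - by rewrite card_option !card_notin cX cards1; lia.
  have linked := edge_rainbow_linked (adj_edge e k true).
  have := rainbow_closed_contract_size linked girth ct.
  by rewrite addn1 ltnS card_option card_notin cX => /leq_ltn_trans lt /lt; lia.
have /card_gt1P[k [i [kj ij ki]]] : 1 < #|[set~ j]| by rewrite cardsC1; lia.
rewrite !inE in kj ij.
have [w sk] := leaves k kj; have [w' si] := leaves i ij.
have [_ Eki] := star_leaves_inj girth h_gt0 sk si.
case/eqP: ki; apply: (adj_colour_inj girth h_gt1 (adj_edge e k true)).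
by apply/existsP; exists true; apply/eqP.
Qed.

Section EdgeCounting.

Variables (V C : finType) (e : C -> bool -> V * V) (h : nat).
Hypothesis nondegen : forall k, nondegenerate e k.
Hypothesis girth : rainbow_girth_gt h e.
Hypothesis h_gt1 : 1 < h.
Let h_gt0 : 0 < h := ltnW h_gt1.

Lemma ends_inj : injective (fun p : C * bool => ends (e p.1 p.2)).
Proof.
move=> [k b] [j c] /= Ekj; have Ek : k = j.
  apply: (adj_colour_inj girth h_gt1 (adj_edge e k b)); apply/existsP; exists c.
  by rewrite -Ekj.
subst j; congr (_, _); apply/eqP; apply: contraNT (nondegen k) => bc; apply/eqP.
by case: b c bc Ekj => [] [].
Qed.

Lemma card_colours_le_bin2 : 2 * #|C| <= 'C(#|V|, 2).
Proof.
have -> : 2 * #|C| = #|[set: C * bool]| by rewrite cardsT card_prod card_bool mulnC.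
rewrite -card_draws -(card_imset _ ends_inj); apply: subset_leq_card.
apply/subsetP=> F /imsetP[[k b] _ ->].
by rewrite inE cards2 (adj_neq girth h_gt0 (adj_edge e k b)).
Qed.

(* A star has one leaf pair but two edges. *)
Lemma leaf_pair_closed_colours_eq0 (A : {set C}) :
  (forall k b, k \in A ->
     exists2 j, j \in A & exists w, star e j w (e k b).1 (e k b).2) ->
  A = set0.
Proof.
move=> family.
have /fin_all_exists[f fP] (p : C * bool) : exists j, p.1 \in A ->
    j \in A /\ exists w, star e j w (e p.1 p.2).1 (e p.1 p.2).2.
  have [pA|] := boolP (p.1 \in A); last by exists p.1.
  by have [j jA leaf] := family p.1 p.2 pA; exists j.
have f_inj : {in setX A [set: bool] &, injective f}.
  move=> p q; rewrite !inE !andbT => pA qA fpq; apply: ends_inj => /=.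
  have [_ [w sp]] := fP p pA; have [_ [w' sq]] := fP q qA; rewrite -fpq in sq.
  by have [] := star_leaves_inj girth h_gt0 sq sp.
have : f @: setX A [set: bool] \subset A.
  by apply/subsetP=> j /imsetP[p]; rewrite !inE andbT => pA ->; have [] := fP p pA.
move/subset_leq_card; rewrite card_in_imset // cardsX cardsT card_bool => two_A_le_A.
by apply/eqP; rewrite -cards_eq0; lia.
Qed.

End EdgeCounting.

Definition short_rainbow_closed n : Prop :=
  forall (V C : finType) (e : C -> bool -> V * V),
    #|V| = n -> 0 < n <= #|C| -> (forall k, nondegenerate e k) ->
    exists2 ks, rainbow_closed e ks & size ks <= uphalf n.

Section MinimalCounterexample.

Variables (V C : finType) (e : C -> bool -> V * V) (h : nat).
Hypothesis nondegen : forall k, nondegenerate e k.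
Hypothesis girth : rainbow_girth_gt h e.
Hypothesis h_gt2 : 2 < h.
Hypothesis card_VC : #|V| <= #|C|.
Hypothesis IHV : forall n, n < #|V| -> short_rainbow_closed n.

Let h_gt1 : 1 < h. Proof. exact: ltnW. Qed.
Let h_gt0 : 0 < h. Proof. exact: ltnW. Qed.
Let no_loop k x y : adj e k x y -> x != y.
Proof. exact: (adj_neq girth h_gt0). Qed.
Let no_digon k j x y : adj e k x y -> adj e j x y -> k = j.
Proof. exact: (adj_colour_inj girth h_gt1). Qed.

Lemma contract_short_rainbow_closed (X : {set V}) (K : {set C}) :
  1 < #|X| -> #|K| < #|X| ->
  (forall k : {k | k \notin K}, nondegenerate (contract X e) k) ->
  exists2 t, rainbow_closed (contract X (K := K) e) t & size t <= uphalf (#|V| - #|X|).+1.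
Proof.
move=> X_gt1 KX contract_nondegen; have XV := max_card X.
apply: (IHV (n := (#|V| - #|X|).+1)) => //; first by lia.
  by rewrite card_option card_notin.
by rewrite card_notin; lia.
Qed.

Lemma girth_lt_contract (X : {set V}) (K : {set C}) D : 1 < #|X| -> #|K| < #|X| ->
  (forall k : {k | k \notin K}, nondegenerate (contract X e) k) ->
  rainbow_linked e X K D -> h < uphalf (#|V| - #|X|).+1 + D.
Proof.
move=> X_gt1 KX contract_nondegen linked.
have [t ct st] := contract_short_rainbow_closed X_gt1 KX contract_nondegen.
apply: leq_trans (rainbow_closed_contract_size linked girth ct) _.
by rewrite leq_add2r.
Qed.

Lemma contract_edge_nondegenerate i a b (K : {set C}) (j : {k | k \notin K}) :
  i \in K -> adj e i a b -> ~~ leaf_pair e a b ->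
  nondegenerate (contract [set a; b] e) j.
Proof.
move=> iK ab; apply: contraNT.
by case/(contract_edge_degenerate girth h_gt1 iK ab (nondegen _))=> w; apply: leaf_pairI.
Qed.

Lemma edge_leaf_pair k a b : uphalf #|V|.-1 < h -> adj e k a b -> leaf_pair e a b.
Proof.
move=> lt_h ab; apply: contraLR lt_h => nab; rewrite -leqNgt.
have card_ab : #|[set a; b]| = 2 by rewrite cards2 (no_loop ab).
have contract_nondegen j := contract_edge_nondegenerate j (set11 k) ab nab.
have := girth_lt_contract _ _ contract_nondegen (edge_rainbow_linked ab).
rewrite card_ab cards1 addn1 ltnS => /(_ isT isT) lt_h.
by have := max_card [set a; b]; rewrite card_ab; lia.
Qed.

Section EvenOrder.

Hypothesis card_V : #|V| = h.*2.

Section UnpairedEdges.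

Variables (k k' : C) (u v y y' : V).
Hypotheses (suvy : star e k u v y) (yy' : adj e k' y y').
Hypotheses (y'u : y' != u) (y'v : y' != v).

Let uv : adj e k u v. Proof. by case/and3P: suvy. Qed.
Let uy : adj e k u y. Proof. by case/and3P: suvy. Qed.
Let yX : y \notin [set u; v].
Proof. by rewrite !inE negb_or eq_sym (no_loop uy) eq_sym; case/andP: suvy. Qed.
Let y'X : y' \notin [set u; v]. Proof. by rewrite !inE negb_or y'u. Qed.

Let kk' : k != k'.
Proof.
apply/eqP=> Ek; move: yy'; rewrite -Ek => /(star_adj suvy).
move: yX; rewrite !inE negb_or => /andP[yu yv].
by case=> /eq_set2[][E1 E2]; move: yu yv y'u y'v; rewrite ?E1 ?E2 eqxx.
Qed.

Let k'_kept : k' \notin [set k]. Proof. by rewrite inE eq_sym. Qed.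
Let kept_k' : {i | i \notin [set k]} := exist _ k' k'_kept.
Let e_uv : {i | i \notin [set k]} -> _ := contract [set u; v] e.
Let Y : {set option {x | x \notin [set u; v]}} := [set insub y; insub y'].

(* A [y]-[y'] walk through the contracted edge first enters it at [u] or [v] and last
   leaves it at [u] or [v]; in each case [uy] or [yy'] or both close up a part of it. *)
Lemma contract_walk_length t :
  walk e_uv (insub y) t (insub y') -> uniq t -> kept_k' \notin t -> h <= size t.
Proof.
move=> wt ut k't.
have uniq_kk' s : subseq s t -> uniq [:: k, k' & map val s].
  move=> st; rewrite /= inE negb_or kk' (map_inj_uniq val_inj) (subseq_uniq st ut) andbT.
  apply/andP; split; apply/mapP=> -[j /(mem_subseq st) jt Ej].
    by have := valP j; rewrite /= -Ej set11.
  by case/negP: k't; rewrite (_ : kept_k' = j) //; apply: val_inj.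
have uniq_k s : subseq s t -> uniq (k :: map val s).
  by move/uniq_kk'; rewrite !cons_uniq inE negb_or -andbA => /and4P[_ -> _ ->].
have uniq_k' s : subseq s t -> uniq (k' :: map val s) by move/uniq_kk'/andP=> [].
case: (walk_uncontract yX y'X wt) => [w|[t1 [t0 [t2 [p [q [Et pX qX w1 w2]]]]]]].
  rewrite -(size_map val).
  by apply: (closing_edge_girth girth w) (uniq_k' t _); rewrite // adj_sym.
have st1 : subseq t1 t by rewrite Et prefix_subseq.
have st2 : subseq t2 t by rewrite Et catA suffix_subseq.
have [Epq|npq] := eqVneq p q.
  rewrite -Epq in w2; have w := walk_trans w1 w2; rewrite -map_cat in w.
  have st12 : subseq (t1 ++ t2) t by rewrite Et cat_subseq ?suffix_subseq.
  apply: leq_trans (size_subseq st12); rewrite -(size_map val).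
  by apply: (closing_edge_girth girth w) (uniq_k' _ st12); rewrite // adj_sym.
have [Ep|pu] := eqVneq p u.
  rewrite Ep in w1; apply: leq_trans (size_subseq st1); rewrite -(size_map val).
  exact: (closing_edge_girth girth w1 uy (uniq_k _ st1)).
have Eq : q = u by move: pX qX npq pu; do 2!case/set2P=> ->; rewrite ?eqxx.
rewrite {q qX npq}Eq in w2.
have w : walk e u (rcons (map val t2) k') y.
  by rewrite -cats1; apply: walk_trans w2 _; rewrite walk1 adj_sym.
have yu : adj e k y u by rewrite adj_sym.
have t1_gt0 : 0 < size t1.
  by case: (t1) w1 => //= /eqP yp; case/negP: yX; rewrite yp.
apply: leq_trans (closing_edge_girth girth w yu _) _.
  by rewrite /= mem_rcons rcons_uniq; have := uniq_kk' _ st2; rewrite !cons_uniq.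
rewrite size_rcons size_map Et !size_cat addnA -add1n leq_add2r.
exact: leq_trans t1_gt0 (leq_addr _ _).
Qed.

Let adj_e_uv_notin j w z : z \notin [set u; v] -> adj e_uv j w (insub z) ->
  exists2 x, insub x = w & adj e (val j) x z.
Proof.
move=> zX /adj_contract[x [z' [Ex Ez xz]]]; exists x => //.
by case/insub_notin_eq: Ez xz => [->|[_]] //; rewrite (negPf zX).
Qed.

Lemma contract_sibling_not_leaf_pair j w : ~~ leaf_pair e y y' -> j != kept_k' ->
  ~~ star e_uv j w (insub y) (insub y').
Proof.
move=> unpaired_yy' jk'; apply/negP=> /and3P[_ /(adj_e_uv_notin yX)[x Ex xy]].
case/(adj_e_uv_notin y'X)=> x'; rewrite -Ex => Ex' x'y'.
have jk : val j != k by have := valP j; rewrite inE.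
have not_centre : x != x'.
  apply: contraNneq unpaired_yy' => Exx; rewrite -Exx in x'y'.
  apply: (leaf_pairI (k := val j) (w := x)).
  by rewrite /star (no_loop yy') xy x'y'.
case/insub_notin_eq: Ex' => [Exx|[x'X xX]]; first by rewrite Exx eqxx in not_centre.
have xu : x != u.
  by apply: contraNneq jk => Exu; rewrite Exu in xy; apply/eqP/(no_digon xy uy).
have Ex' : x' = u by move: x'X xX not_centre xu; do 2!case/set2P=> ->; rewrite ?eqxx.
rewrite Ex' adj_sym in x'y'.
apply: (@no_rainbow_triangle _ _ _ _ girth k k' (val j) u y y') => //.
rewrite /= !inE negb_or kk' eq_sym jk /= andbT.
by apply: contraNneq jk' => Ej; apply/eqP/val_inj.
Qed.

Lemma contract_twice_nondegenerate
    (K : {set {i | i \notin [set k]}}) (j : {i | i \notin K}) :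
  ~~ leaf_pair e u v -> ~~ leaf_pair e y y' -> kept_k' \in K ->
  nondegenerate (contract Y e_uv) j.
Proof.
move=> unpaired_uv unpaired_yy' k'K.
have girth_uv : rainbow_girth_gt h.-1 e_uv.
  move=> t /(rainbow_closed_contract_size (edge_rainbow_linked uv) girth).
  by rewrite addn1 ltnS prednK.
have h_pred_gt1 : 1 < h.-1 by rewrite -ltnS prednK.
have e_uv_yy' : adj e_uv kept_k' (insub y) (insub y').
  have /existsP[b /eqP/(@eq_set2 _) Eb] := yy'.
  apply/existsP; exists b; apply/eqP.
  by rewrite /ends /=; case: Eb => -[-> ->]; last exact: setUC.
have nondegen_uv i : nondegenerate e_uv i.
  exact: contract_edge_nondegenerate (set11 k) uv unpaired_uv.
have jk' : val j != kept_k' by apply: contraNneq (valP j) => ->.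
apply: contraT.
case/(contract_edge_degenerate girth_uv h_pred_gt1 k'K e_uv_yy' (nondegen_uv _))=> w.
by rewrite (negPf (contract_sibling_not_leaf_pair w unpaired_yy' jk')).
Qed.

Lemma unpaired_edge_sibling : ~~ leaf_pair e u v -> leaf_pair e y y'.
Proof.
move=> unpaired_uv; apply: contraT => unpaired_yy'.
have cX : #|[set u; v]| = 2 by rewrite cards2 (no_loop uv).
have cY : #|Y| = 2.
  rewrite cards2; case: eqVneq => // /insub_notin_eq[E|[]]; last by rewrite (negPf yX).
  by have := no_loop yy'; rewrite E eqxx.
have cW : #|{: option {x | x \notin Y}}| = h.*2 - 2.
  rewrite card_option card_notin cY card_option card_notin cX card_V.
  by clear -h_gt2; lia.
have [|||t ct st] := @IHV (h.*2 - 2) _ _ _ (contract Y (K := [set kept_k']) e_uv) cW.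
- by rewrite card_V; clear -h_gt2; lia.
- by rewrite !card_notin !cards1; clear -card_VC card_V h_gt2; lia.
- by move=> j; apply: contract_twice_nondegenerate (set11 kept_k').
have [ks [p [q [ks0 uks kst ksk' [w pq]]]]] := rainbow_closed_uncontract ct.
have ks_lt_h : size ks < h.
  by apply: leq_ltn_trans kst (leq_ltn_trans st _); clear -h_gt2; lia.
have [Epq|npq] := eqVneq p q.
  rewrite Epq in w; have := rainbow_closed_walk ks0 uks w.
  move/(rainbow_closed_contract_size (edge_rainbow_linked uv) girth).
  by rewrite addn1 ltnS leqNgt ks_lt_h.
have k'ks : kept_k' \notin ks by apply/negP=> /ksk'; rewrite set11.
move: ks_lt_h; rewrite ltnNge => /negP[]; rewrite (negPf npq) /= in pq.
case/andP: pq npq w => /set2P[]-> /set2P[]->; rewrite ?eqxx // => _.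
  by move/contract_walk_length; apply.
rewrite -walk_rev -size_rev => /contract_walk_length; apply; first by rewrite rev_uniq.
by rewrite mem_rev.
Qed.

End UnpairedEdges.

Section Wheel.

(* Every [w \in M] is a leaf, together with the hub [y], of a star [c w] whose centre
   [p w] is again in [M]. *)
Variables (y : V) (M : {set V}) (p : V -> V) (c : V -> C).
Hypothesis wheel : {in M, forall w, p w \in M /\ star e (c w) (p w) y w}.
Hypothesis M_neq0 : M != set0.

Let K : {set C} := [set c w | w in M].
Let X : {set V} := y |: M.

Let rim_star w : w \in M -> star e (c w) (p w) y w. Proof. by case/wheel. Qed.
Let rim_edge w : w \in M -> adj e (c w) (p w) w. Proof. by case/rim_star/and3P. Qed.

Lemma rim_colour_inj : {in M &, injective c}.
Proof.
move=> w w' wM w'M Ec; have := rim_star w'M; rewrite -Ec => s'.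
by have [_ /eq_set2[[]|[-> ->]]] := star_leaves_inj girth h_gt0 (rim_star wM) s'.
Qed.

Lemma rim_inj : {in M &, injective p}.
Proof.
move=> w w' wM w'M Ep; apply: rim_colour_inj => //.
have /and3P[_ yw _] := rim_star wM; have /and3P[_ yw' _] := rim_star w'M.
by rewrite Ep in yw; apply: no_digon yw yw'.
Qed.

Lemma iter_rim n w : w \in M -> iter n p w \in M.
Proof. by move=> wM; elim: n => //= n /wheel[]. Qed.

Lemma walk_rim n w : w \in M -> walk e w (map c (traject p w n)) (iter n p w).
Proof.
elim: n w => [|n IHn] w wM; first exact: eqxx.
rewrite trajectS iterSr; apply/existsP; exists (p w).
apply/andP; split; first by rewrite adj_sym rim_edge.
by apply: IHn; case/wheel: wM.
Qed.

Lemma card_rim_gt : h < #|M|.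
Proof.
have /set0Pn[w wM] := M_neq0.
have orbM : {subset orbit p w <= M} by move=> _ /trajectP[i _ ->]; apply: iter_rim.
apply: (@leq_trans (size (orbit p w))); last first.
  rewrite cardE; apply: uniq_leq_size (orbit_uniq p w) _ => x /orbM.
  by rewrite mem_enum.
rewrite -(size_map c); apply: girth; apply: (rainbow_closed_walk (x := w)).
- by rewrite -size_eq0 size_map size_orbit -lt0n order_gt0.
- rewrite map_inj_in_uniq ?orbit_uniq // => x z /orbM xM /orbM.
  exact: rim_colour_inj.
have closed_orbit : iter (order p w) p w = w.
  by apply: iter_order_in wM; [apply: iter_rim 1 | apply: rim_inj].
by have := walk_rim (order p w) wM; rewrite closed_orbit.
Qed.

Lemma hub_notin_rim : y \notin M.
Proof. by apply/negP=> /rim_star/and3P[]; rewrite eqxx. Qed.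

Lemma rim_onto w : w \in M -> exists2 w', w' \in M & p w' = w.
Proof.
move=> wM; have pM : p @: M = M.
  apply/eqP; rewrite eqEcard card_in_imset ?leqnn ?andbT; last exact: rim_inj.
  by apply/subsetP=> _ /imsetP[x /wheel[pxM _] ->].
by move: wM; rewrite -{1}pM => /imsetP[w' w'M ->]; exists w'.
Qed.

Lemma wheel_spokes : rainbow_spokes e X K y.
Proof.
split=> [w /setU1P[->|wM] wy|_ /imsetP[w wM ->] a b aX bX].
- by rewrite eqxx in wy.
- have [w' w'M <-] := rim_onto wM; exists (c w'); first exact: imset_f.
  by rewrite adj_sym; case/and3P: (rim_star w'M).
apply/negP=> syab; have [Ey _] := star_leaves_inj girth h_gt0 (rim_star wM) syab.
by case/negP: hub_notin_rim; rewrite Ey; case/wheel: wM.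
Qed.

Let yX : y \in X := setU11 y M.
Let linked : rainbow_linked e X K 2 := rainbow_spokes_linked wheel_spokes yX.
Let cX : #|X| = #|M|.+1. Proof. by rewrite cardsU1 hub_notin_rim. Qed.
Let cK : #|K| = #|M|. Proof. by rewrite card_in_imset //; apply: rim_colour_inj. Qed.

Lemma wheel_contract_degenerate (k : {k | k \notin K}) :
  ~~ nondegenerate (contract X e) k.
Proof.
apply/negP=> /rainbow_closed_lt_card; rewrite card_option !card_notin cX cK.
have := max_card X; rewrite cX card_V => MV; have Mh := card_rim_gt.
case=> [|t ct st]; first by clear -card_VC card_V MV Mh; lia.
have := rainbow_closed_contract_size linked girth ct.
rewrite ltnNge -addSnnS (leq_trans (leq_add st (leqnn 1))) //.
by clear -MV Mh; lia.
Qed.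

Definition outer_star k v a b : Prop :=
  [/\ k \notin K, v \notin X, a \in X, b \in X & star e k v a b].

Lemma outer_colour_star (k : {k | k \notin K}) :
  exists v a b, outer_star (val k) v a b.
Proof.
have no_inner := rainbow_spokes_no_inner_edge girth h_gt2 wheel_spokes (valP k).
have [[a [b [aX bX ab]]]|[v [a [b [vX aX bX sv]]]]] :=
  contract_degenerate (nondegen _) (wheel_contract_degenerate k).
  by case/negP: (no_inner a b aX bX).
by exists v, a, b; split=> //; apply: (valP k).
Qed.

(* There are more colours outside [K] than possible centres outside [X]. *)
Lemma concentric_outer_stars : exists j j' v a a' b b',
  [/\ j != j', outer_star j v a a' & outer_star j' v b b'].
Proof.
have /fin_all_exists[f fP] := outer_colour_star.
have /injectivePn[j [j' jj' Ef]] : ~~ injectiveb f.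
  apply: contraL card_rim_gt => /injectiveP f_inj; rewrite -leqNgt.
  have : #|f @: [set: {k | k \notin K}]| <= #|~: X|.
    apply: subset_leq_card; apply/subsetP=> _ /imsetP[k _ ->]; rewrite inE.
    by have [a [b []]] := fP k.
  rewrite (card_imset _ f_inj) cardsT card_notin cK; have := cardsC X; rewrite cX card_V.
  by clear -card_VC card_V; lia.
have [a [a' sa]] := fP j; have [b [b' sb]] := fP j'; rewrite -Ef in sb.
by exists (val j), (val j'), (f j), a, a', b, b'.
Qed.

Section ConcentricStars.

Variables (j j' : C) (v a a' b b' : V).
Hypotheses (jj' : j != j') (sa : outer_star j v a a') (sb : outer_star j' v b b').

Let A := [set a; a'].
Let B := [set b; b'].

Let jK : j \notin K. Proof. by case: sa. Qed.
Let j'K : j' \notin K. Proof. by case: sb. Qed.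
Let aX : a \in X. Proof. by case: sa. Qed.
Let bX : b \in X. Proof. by case: sb. Qed.
Let aA : a \in A := set21 a a'.
Let a'A : a' \in A := set22 a a'.
Let bB : b \in B := set21 b b'.

Let adj_A x : x \in A -> adj e j v x.
Proof. by case: sa => _ _ _ _ /and3P[_ va va'] /set2P[]->. Qed.
Let adj_B x : x \in B -> adj e j' v x.
Proof. by case: sb => _ _ _ _ /and3P[_ vb vb'] /set2P[]->. Qed.

Lemma concentric_leaves_neq x z : x \in A -> z \in B -> x != z.
Proof.
move=> /adj_A vx /adj_B vz; apply: contraNneq jj' => Exz.
by rewrite Exz in vx; rewrite (no_digon vx vz).
Qed.

Lemma concentric_leaves_not_adj i x z : i \in K -> x \in A -> z \in B -> ~~ adj e i x z.
Proof.
move=> iK /adj_A vx /adj_B vz; apply/negP=> xz; rewrite adj_sym in vz.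
apply: (@no_rainbow_triangle _ _ _ _ girth j i j' v x z) => //.
rewrite /= !inE negb_or jj' andbT; apply/and3P; split=> //.
  by apply: contraNneq jK => ->.
by apply: contraNneq j'K => <-.
Qed.

Lemma concentric_stars_girth : h <= 3.
Proof.
have [ks [w uks ks2 ksK]] := linked aX bX.
apply: leq_trans (_ : (size ks).+1 <= 3) => //.
apply: (closing_edge_girth girth (ks := j :: ks) (x := v) (k := j') (y := b)).
- by apply/existsP; exists a; rewrite adj_A.
- by rewrite adj_sym adj_B.
rewrite /= inE negb_or eq_sym jj' uks andbT.
by apply/andP; split; [apply: contra j'K | apply: contra jK] => /ksK.
Qed.

Lemma hub_notin_leaves : y \notin A :|: B.
Proof.
apply/negP=> /setUP[yA|yB].
  have [|i iK yb] := wheel_spokes.1 b bX.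
    by rewrite eq_sym; apply: concentric_leaves_neq yA bB.
  by case/negP: (concentric_leaves_not_adj iK yA bB).
have [|i iK ya] := wheel_spokes.1 a aX; first exact: concentric_leaves_neq aA yB.
by case/negP: (concentric_leaves_not_adj iK aA yB); rewrite adj_sym.
Qed.

Lemma rim_eq_leaves : M = A :|: B.
Proof.
apply/eqP; rewrite eq_sym eqEcard; apply/andP; split.
  apply/subsetP=> x xAB; suff /setU1P[xy|//] : x \in X.
    by case/negP: hub_notin_leaves; rewrite -xy.
  by case: sa sb xAB => _ _ _ a'X _ [_ _ _ b'X _] /setUP[]/set2P[]->.
have AB0 : A :&: B = set0.
  apply/setP=> x; rewrite in_set0; apply/negP=> /setIP[xA xB].
  by have := concentric_leaves_neq xA xB; rewrite eqxx.
have vX : v \notin X by case: sa.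
case: sa sb => _ _ _ _ /and3P[aa' _ _] [_ _ _ _ /and3P[bb' _ _]].
rewrite cardsU AB0 !cards2 cards0 aa' bb'.
have := max_card (v |: X); rewrite cardsU1 vX cX card_V.
by have := concentric_stars_girth; clear; lia.
Qed.

Lemma concentric_stars_absurd : False.
Proof.
have pA x : x \in A -> p x \in A /\ p x != x.
  move=> xA; have xM : x \in M by rewrite rim_eq_leaves inE xA.
  have rx := rim_edge xM; split; last exact: no_loop rx.
  have [] := wheel xM; rewrite {1}rim_eq_leaves inE => /orP[//|pB] _.
  by have := concentric_leaves_not_adj (imset_f c xM) xA pB; rewrite adj_sym rx.
have [[pa npa] [pa' npa']] := (pA a aA, pA a' a'A).
have AM x : x \in A -> x \in M by rewrite rim_eq_leaves in_setU => ->.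
have [aM a'M] := (AM a aA, AM a' a'A).
have Epa : p a = a' by case/set2P: pa npa => -> //; rewrite eqxx.
have Epa' : p a' = a by case/set2P: pa' npa' => -> //; rewrite eqxx.
have := rim_edge a'M; have := rim_edge aM; rewrite Epa Epa' adj_sym => aa' a'a.
have /and3P[/eqP neq_aa' _ _] : star e j v a a' by case: sa.
by apply: neq_aa'; apply: rim_colour_inj => //; apply: no_digon aa' a'a.
Qed.

End ConcentricStars.

End Wheel.

Lemma no_wheel y (M : {set V}) : M != set0 ->
  {in M, forall w', exists2 w, w \in M & leaf_pair_at e w y w'} -> False.
Proof.
move=> M_neq0 closedM; have /set0Pn[w0 w0M] := M_neq0.
have [_ _ /existsP[k0 _]] := closedM w0 w0M.
have /fin_all_exists[pc pcP] w : exists q : V * C, w \in M ->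
    q.1 \in M /\ star e q.2 q.1 y w.
  have [wM|_] := boolP (w \in M); last by exists (w, k0).
  by have [w' w'M /existsP[k sk]] := closedM w wM; exists (w', k).
pose c w := (pc w).2.
have wheel : {in M, forall w, (pc w).1 \in M /\ star e (c w) (pc w).1 y w} := pcP.
have [j [j' [v [a [a' [b [b' [jj' sa sb]]]]]]]] := concentric_outer_stars wheel M_neq0.
exact: (concentric_stars_absurd wheel) jj' sa sb.
Qed.

Lemma no_pendant_vertex k y u : adj e k y u -> neighbours e y \subset [set u] -> False.
Proof.
move=> yu /subsetP Ny; have nyu := no_loop yu.
have only_edge j w : adj e j y w -> j = k /\ w = u.
  move=> yw; have wu : w = u by apply/set1P/Ny/mem_neighbours/yw.
  by rewrite wu in yw *; rewrite (no_digon yw yu).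
have cX : #|[set y; u]| = 2 by rewrite cards2 nyu.
have nleaf : ~~ leaf_pair e y u.
  apply/leaf_pairP=> -[j [w /and3P[_ wy wu]]]; rewrite adj_sym in wy.
  by have [_ Ew] := only_edge _ _ wy; have := no_loop wu; rewrite Ew eqxx.
have [||j|t ct] := @contract_short_rainbow_closed [set y; u] [set k].
- by rewrite cX.
- by rewrite cX cards1.
- exact: contract_edge_nondegenerate (set11 k) yu nleaf.
rewrite cX card_V => st.
have [ks [p [q [ks0 uks kst ks_k [w pq]]]]] := rainbow_closed_uncontract ct.
have [Epq|npq] := eqVneq p q.
  rewrite Epq in w; have := girth (rainbow_closed_walk ks0 uks w).
  by rewrite ltnNge (leq_trans kst) // (leq_trans st) //; clear -h_gt2; lia.
have no_exit js x : js != [::] -> {in js, forall j, j \notin [set k]} -> ~~ walk e y js x.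
  case: js => // j js _ js_k; apply/existsP=> -[z /andP[/only_edge[Ej _] _]].
  by have := js_k j (mem_head _ _); rewrite Ej set11.
rewrite (negPf npq) /= in pq.
case/andP: pq npq w => /set2P[]-> /set2P[]->; rewrite ?eqxx // => _.
  exact/negP/no_exit.
rewrite -walk_rev; apply/negP/no_exit; first by rewrite -size_eq0 size_rev size_eq0.
by move=> j; rewrite mem_rev; apply: ks_k.
Qed.

Section UnpairedStar.

Variables (k : C) (u v y : V).
Hypotheses (suvy : star e k u v y) (unpaired_uv : ~~ leaf_pair e u v).

Let vy : v != y. Proof. by case/and3P: suvy. Qed.
Let uv : adj e k u v. Proof. by case/and3P: suvy. Qed.
Let uy : adj e k u y. Proof. by case/and3P: suvy. Qed.
Let N := neighbours e y.

Let uN : u \in N. Proof. by apply: (mem_neighbours (k := k)); rewrite adj_sym. Qed.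

Lemma neighbour_is_leaf w' : w' \in N -> w' != u -> exists w, leaf_pair_at e w y w'.
Proof.
rewrite inE => /existsP[j yw'] w'u; have [->|w'v] := eqVneq w' v.
  by exists u; apply: (leaf_pair_atI (k := k)); rewrite starC.
exact/existsP/(unpaired_edge_sibling suvy yw' w'u w'v unpaired_uv).
Qed.

Lemma centre_leaf_uniq w' : leaf_pair_at e u y w' -> w' = v.
Proof.
case/existsP=> j sj; have /and3P[_ uy' _] := sj; rewrite (no_digon uy' uy) in sj.
have [_ /eq_set2[[Ey _]|[_ ->//]]] := star_leaves_inj girth h_gt0 suvy sj.
by have := vy; rewrite Ey eqxx.
Qed.

Lemma centre_not_leaf w : ~~ leaf_pair_at e w y u.
Proof.
apply/negP=> wu; apply: (@no_wheel y N); first by apply/set0Pn; exists u.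
move=> x xN; have [z zx] : exists z, leaf_pair_at e z y x.
  by have [->|] := eqVneq x u; [exists w | apply: neighbour_is_leaf].
by exists z; rewrite // (leaf_pair_at_neighbour zx).
Qed.

Lemma leaf_has_one_centre :
  ~ (v \in N -> exists2 w, w != u & leaf_pair_at e w y v).
Proof.
move=> other; have [Nu0|Nu] := eqVneq (N :\ u) set0.
  have yu : adj e k y u by rewrite adj_sym.
  by apply: (no_pendant_vertex yu); rewrite -setD_eq0 -Nu0.
apply: (no_wheel (y := y) Nu) => x /setD1P[xu xN].
have [w wu wx] : exists2 w, w != u & leaf_pair_at e w y x.
  have [Ex|xv] := eqVneq x v; first by rewrite Ex in xN *; apply: other.
  have [w wx] := neighbour_is_leaf xN xu; exists w => //.
  by apply: contraNneq xv => Ew; rewrite Ew in wx; apply/eqP/centre_leaf_uniq.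
by exists w; rewrite // in_setD1 wu (leaf_pair_at_neighbour wx).
Qed.

Lemma unpaired_star_triangle_clique k' : adj e k' y v ->
  colour_clique e [set u; v; y] [set k; k'].
Proof.
have [kK k'K] : k \in [set k; k'] /\ k' \in [set k; k'] by rewrite set21 set22.
rewrite /colour_clique => yv x z; rewrite !inE -!orbA.
case/or3P=> /eqP-> /or3P[]/eqP->; rewrite ?eqxx // => _;
  by [exists k; rewrite // adj_sym | exists k'; rewrite // adj_sym].
Qed.

Lemma no_unpaired_star : False.
Proof.
apply: leaf_has_one_centre; rewrite inE => /existsP[k' yv].
have [/existsP[w /andP[wu wv]]|only_centre] :=
  boolP [exists w, (w != u) && leaf_pair_at e w y v].
  by exists w.
exfalso; pose X := [set u; v; y]; pose K := [set k; k'].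
have clique : colour_clique e X K := unpaired_star_triangle_clique yv.
have cX : #|X| = 3.
  rewrite /X setUC cardsU1 !inE negb_or ![y == _]eq_sym (no_loop uy) vy cards2.
  by rewrite (no_loop uv).
have contract_nondegen (j : {j | j \notin K}) : nondegenerate (contract X e) j.
  apply: contract_nondegenerate; rewrite ?nondegen //.
    exact: (clique_no_inner_edge girth h_gt1 clique (valP j)).
  move=> w wX; have wu : w != u by apply: contraNneq wX => ->; rewrite !inE eqxx.
  have no_uv : ~~ star e (val j) w u v by apply: contra unpaired_uv; apply: leaf_pairI.
  have no_yu : ~~ star e (val j) w y u.
    by apply: contra (centre_not_leaf w); apply: leaf_pair_atI.
  have no_yv : ~~ star e (val j) w y v.
    apply: contra only_centre => /leaf_pair_atI sw.
    by apply/existsP; exists w; rewrite wu.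
  move=> a b; rewrite !inE -!orbA => /or3P[]/eqP-> /or3P[]/eqP->;
    by rewrite // 1?starC // /star eqxx.
have := girth_lt_contract _ _ contract_nondegen (clique_rainbow_linked clique).
rewrite cX card_V cards2 => /(_ isT); case: (k != k') => /(_ isT).
all: by clear -h_gt2; lia.
Qed.

End UnpairedStar.

Lemma star_edge_leaf_pair k u v y : star e k u v y -> leaf_pair e u v.
Proof. by move=> suvy; have [//|/(no_unpaired_star suvy)] := boolP (leaf_pair e u v). Qed.

Lemma no_star k w a b : ~~ star e k w a b.
Proof.
pose stars := [set j | [exists x, exists y, exists z, star e j x y z]].
have mem_stars j x y z : star e j x y z -> j \in stars.
  by rewrite inE => s; do 3!(apply/existsP; eexists); apply: s.
suff stars0 : stars = set0 by apply/negP=> /mem_stars; rewrite stars0 inE.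
apply: (leaf_pair_closed_colours_eq0 nondegen girth h_gt1) => j c.
rewrite inE => /existsP[x /existsP[y /existsP[z sxyz]]].
suff /leaf_pairP[i [w' sw']] : leaf_pair e (e j c).1 (e j c).2.
  by exists i; [apply: mem_stars sw' | exists w'].
have xy := star_edge_leaf_pair sxyz.
have xz : leaf_pair e x z by apply: (@star_edge_leaf_pair j x z y); rewrite starC.
case/(star_adj sxyz): (adj_edge e j c) => /eq_set2[][-> ->];
  by rewrite ?xy ?xz // leaf_pairC.
Qed.

Lemma adj_uniq k x y z : adj e k x y -> adj e k x z -> y = z.
Proof.
move=> xy xz; apply: contraNeq (no_star k x y z) => yz.
by rewrite /star yz xy xz.
Qed.

Lemma card_neighbours x : #|neighbours e x| = #|colours_at e x|.
Proof.
have /fin_all_exists[t tP] k : exists y, k \in colours_at e x -> adj e k x y.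
  have [|_] := boolP (k \in colours_at e x); last by exists x.
  by rewrite inE => /existsP[y xy]; exists y.
have -> : neighbours e x = t @: colours_at e x.
  apply/setP=> y; apply/idP/imsetP=> [|[k /tP xy ->]]; last exact: mem_neighbours xy.
  rewrite inE => /existsP[k xy]; have kx := mem_colours_at xy.
  by exists k => //; apply: adj_uniq xy (tP k kx).
rewrite card_in_imset // => k j /tP xk /tP xj Et.
by rewrite -Et in xj; apply: no_digon xk xj.
Qed.

Lemma card_colour_support k : 4 <= #|[set x | k \in colours_at e x]|.
Proof.
have endsP b x : x \in ends (e k b) -> exists2 y, adj e k x y & ends (e k b) = [set x; y].
  case/set2P=> ->; first by exists (e k b).2; rewrite // adj_edge.
  by exists (e k b).1; rewrite 1?adj_sym ?adj_edge // [RHS]setUC.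
have cE b : #|ends (e k b)| = 2 by rewrite cards2 (no_loop (adj_edge e k b)).
have : #|ends (e k true) :|: ends (e k false)| = 4.
  rewrite cardsU !cE; have -> : ends (e k true) :&: ends (e k false) = set0.
    apply/setP=> x; rewrite in_set0; apply/negP=> /setIP[/endsP[y xy Et] /endsP[z xz Ef]].
    by case/negP: (nondegen k); rewrite /nondegenerate Et Ef (adj_uniq xy xz).
  by rewrite cards0.
move=> <-; apply: subset_leq_card; apply/subsetP=> x /setUP[]/endsP[y xy _].
all: by rewrite inE; apply: mem_colours_at xy.
Qed.

Lemma exists_four_neighbours : exists x, 3 < #|neighbours e x|.
Proof.
apply/existsP; apply: contraT; rewrite negb_exists => /forallP small.
have : #|C| * 4 <= #|V| * 3; last by move: card_VC; rewrite card_V; clear -h_gt2; lia.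
apply: (@leq_trans (\sum_(k : C) \sum_(x | k \in colours_at e x) 1)).
  rewrite -sum_nat_const; apply: leq_sum => k _.
  by rewrite sum1dep_card card_colour_support.
rewrite (exchange_big_dep xpredT) //= -sum_nat_const; apply: leq_sum => x _.
by rewrite sum1_card -card_neighbours leqNgt.
Qed.

Lemma no_even_counterexample : False.
Proof.
have [u Nu] := exists_four_neighbours.
pose X := u |: neighbours e u; pose K := colours_at e u.
have uN : u \notin neighbours e u.
  by rewrite inE; apply/existsP=> -[k /no_loop]; rewrite eqxx.
have cX : #|X| = #|K|.+1 by rewrite cardsU1 uN card_neighbours.
have spokes : rainbow_spokes e X K u.
  split=> [x /setU1P[->|]|k _ a b _ _]; rewrite ?eqxx ?no_star // inE => /existsP[k ux] _.
  by exists k; rewrite // (mem_colours_at ux).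
have contract_nondegen (k : {k | k \notin K}) : nondegenerate (contract X e) k.
  apply: contract_nondegenerate => [||w _ a b _ _]; rewrite ?no_star //.
  exact: (rainbow_spokes_no_inner_edge girth h_gt2 spokes (valP k)).
have K_gt3 : 3 < #|K| by rewrite -card_neighbours.
have KX : #|K| < #|X| by rewrite cX.
have := girth_lt_contract (leq_trans (ltnW (ltnW K_gt3)) (ltnW KX)) KX contract_nondegen
  (rainbow_spokes_linked spokes (setU11 _ _)).
by have := max_card X; rewrite cX card_V; clear -K_gt3; lia.
Qed.

End EvenOrder.

End MinimalCounterexample.

Lemma short_rainbow_closed_all n : short_rainbow_closed n.
Proof.
elim/ltn_ind: n => n IHn V C e cV /andP[n0 nC] nondegen.
have card_VC : #|V| <= #|C| by rewrite cV.
have IHV m : m < #|V| -> short_rainbow_closed m by rewrite cV; apply: IHn.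
have /card_gt0P[k0 _] := leq_trans n0 nC.
have [n_le3|n_gt3] := leqP n 3.
  have [ks cks] := rainbow_closed_lt_card card_VC (nondegen k0).
  by rewrite cV => ksn; exists ks => //; clear -ksn n_le3; lia.
have [//|girth] := short_rainbow_closed_or_girth_gt (uphalf n) e; exfalso.
have h_gt1 : 1 < uphalf n by clear -n_gt3; lia.
have n_gt4 : 4 < n.
  have := card_colours_le_bin2 nondegen girth h_gt1; rewrite cV ltnNge => two_C_le_bin2.
  apply/negP=> n_le4; have n_eq4 : n = 4 by clear -n_gt3 n_le4; lia.
  by move: two_C_le_bin2 nC; rewrite n_eq4 (_ : 'C(4, 2) = 6) //; clear; lia.
have h_gt2 : 2 < uphalf n by clear -n_gt4; lia.
have [odd_n|even_n] := boolP (odd n); last first.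
  apply: (no_even_counterexample nondegen girth h_gt2 card_VC IHV).
  by rewrite cV; clear -even_n; lia.
have contract_lt_h : uphalf #|V|.-1 < uphalf n by rewrite cV; clear -odd_n; lia.
suff /setP/(_ k0) : [set: C] = set0 by rewrite !inE.
apply: (leaf_pair_closed_colours_eq0 nondegen girth h_gt1) => k b _.
have /leaf_pairP[j [w sw]] :=
  edge_leaf_pair nondegen girth h_gt2 card_VC IHV contract_lt_h (adj_edge e k b).
by exists j; last by exists w.
Qed.

Section RainbowCycle.

Variables (T C : finType) (r : rel T) (c : {set T} -> C) (e : C -> bool -> T * T).
Hypothesis simple : simple_graph r.
Hypothesis edgeP : forall k b, r (e k b).1 (e k b).2 /\ c (ends (e k b)) = k.

Lemma adj_graph k x y : adj e k x y -> r x y /\ c [set x; y] = k.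
Proof.
case/existsP=> b /eqP Exy; have [rb <-] := edgeP k b; split; last by rewrite Exy.
by case/eq_set2: Exy rb => -[-> ->]; rewrite // simple.1.
Qed.

Lemma walk_vertices x ks y : walk e x ks y -> exists (D : seq (T * T)) (p : seq T),
  [/\ map (fun d => c [set d.1; d.2]) D = ks, {in D, forall d, r d.1 d.2},
      path [rel a b | (a, b) \in D] x p, last x p = y & size p = size ks].
Proof.
elim: ks x => [|k ks IHks] x /=; first by move/eqP<-; exists [::], [::].
case/existsP=> z /andP[/adj_graph[rxz ck] /IHks[D [p [Dks rD pathp lastp sp]]]].
exists ((x, z) :: D), (z :: p); split; rewrite /= ?ck ?Dks ?sp //.
  by move=> d; rewrite inE => /predU1P[->|/rD].
rewrite mem_head; apply: sub_path pathp => a b /= abD.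
by rewrite inE abD orbT.
Qed.

(* Shortening a closed walk to a cycle keeps it rainbow because the directed edges [D]
   that it uses have distinct colours. *)
Lemma rainbow_closed_cycle ks : rainbow_closed e ks -> exists p : seq T,
  [/\ graph_cycle r p, size p <= size ks & rainbow c (cycle_edges p)].
Proof.
case/and3P=> ks0 uks /existsP[x /walk_vertices[D [[|y p] [Dks rD]]]].
  by move=> _ _ sks; rewrite -size_eq0 -sks in ks0.
rewrite /= => /andP[xyD]; case/shortenP=> q pathq uq qp lastq sks.
have cD := uniq_map_inj_in (etrans (congr1 uniq Dks) uks).
have cyc : cycle [rel a b | (a, b) \in D] (y :: q) by rewrite /= rcons_path pathq lastq.
have nextD z : z \in y :: q -> (z, next (y :: q) z) \in D := next_cycle cyc.
have sqp : size (y :: q) <= size ks.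
  by rewrite -sks ltnS; apply: uniq_leq_size qp; case/andP: uq.
have size_gt2 : 2 < size (y :: q).
  case: (q) cyc uq => [|z [|//]] /=; first by rewrite andbT => /rD; rewrite simple.2.
  rewrite andbT inE => /andP[yzD zyD] /andP[/negP yz _]; case: yz.
  have /eqP : (y, z) = (z, y) by apply: cD; rewrite //= setUC.
  by rewrite xpair_eqE => /andP[].
exists (y :: q); split=> //.
  by split; rewrite // /ucycle uq andbT; apply: sub_cycle cyc => a b /rD.
move=> _ _ /imsetP[z zq ->] /imsetP[z' z'q ->] Ec.
by have [Ez _] := cD _ _ (nextD z zq) (nextD z' z'q) Ec; rewrite Ez.
Qed.

End RainbowCycle.

Theorem theorem1p5 (n : nat) (T : finType) (e : rel T)
    (C : finType) (c : {set T} -> C) :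
  0 < n ->
  simple_graph e ->
  #|T| = n ->
  #|C| = n ->
  (forall k : C, 2 <= #|colour_class e c k|) ->
  exists p : seq T,
    [/\ graph_cycle e p, size p <= uphalf n & rainbow c (cycle_edges p)].
Proof.
move=> n0 simple cT cC class2.
have /fin_all_exists[g gP] (k : C) : exists g : bool -> T * T,
    (forall b, e (g b).1 (g b).2 /\ c (ends (g b)) = k) /\
    ends (g true) != ends (g false).
  have edgeP F : F \in colour_class e c k ->
      exists q : T * T, [/\ e q.1 q.2, c (ends q) = k & F = ends q].
    by rewrite inE => /andP[/imsetP[q]]; rewrite inE => eq -> /eqP; exists q.
  have /card_gt1P[_ [_ [/edgeP[q [eq cq ->]] /edgeP[q' [eq' cq' ->]] qq']]] := class2 k.
  by exists (fun b => if b then q else q'); split=> // -[].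
have [|k|ks cks sks] := @short_rainbow_closed_all n T C g cT.
- by rewrite n0 cC leqnn.
- by have [] := gP k.
have [p [cp sp rp]] := rainbow_closed_cycle simple (fun k b => (gP k).1 b) cks.
by exists p; split=> //; apply: leq_trans sks.
Qed.
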